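(* Let $F$ be a continuous distribution function on $\mathcal{X}\subseteq\mathbb{R}^p$ for which the expectations below are finite. Suppose that the full point set $\mathcal{P}_n=\{\boldsymbol{x}_i\}_{i=1}^n\subseteq\mathcal{X}$ is divided into $K$ subsets $\mathcal{P}_{n_1},\ldots,\mathcal{P}_{n_K}$, i.e. $\mathcal{P}_n=\bigcup_{k=1}^K\mathcal{P}_{n_k}$ with $\sum_{k=1}^K n_k=n$, where $\mathcal{P}_{n_k}$ contains $n_k\ge 1$ points. Then $$\begin{aligned} E(F,F_{\mathcal{P}_n})&=\sum_{k=1}^K\frac{n_k}{n}E(F,F_{\mathcal{P}_{n_k}})-\sum_{1\le k_1<k_2\le K}\frac{n_{k_1}n_{k_2}}{n^2}E(F_{\mathcal{P}_{n_{k_1}}},F_{\mathcal{P}_{n_{k_2}}})\\ &=\sum_{k=1}^K\frac{n_k}{n}E(F,F_{\mathcal{P}_{n_k}})-\sum_{k_1=1}^K\sum_{k_2=1}^K\frac{n_{k_1}n_{k_2}}{2n^2}E(F_{\mathcal{P}_{n_{k_1}}},F_{\mathcal{P}_{n_{k_2}}})\\ &=\sum_{k=1}^K\frac{n_k}{n}\left[E(F,F_{\mathcal{P}_{n_k}})-E(F_{\mathcal{P}_n},F_{\mathcal{P}_{n_k}})\right]. \end{aligned}$$ In particular, when $K=2$, $$E(F,F_{\mathcal{P}_n})=\frac{n_1}{n}E(F,F_{\mathcal{P}_{n_1}})+\frac{n_2}{n}E(F,F_{\mathcal{P}_{n_2}})-\frac{n_1n_2}{n^2}E(F_{\mathcal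{P}_{n_1}},F_{\mathcal{P}_{n_2}}).$$
   Context: Point sets are finite indexed families of points (repetitions allowed and counted with multiplicity); dividing a point set means partitioning its index set. $F_{\mathcal{P}}$ denotes the empirical distribution function of a point set $\mathcal{P}$. For $Y,Y'\stackrel{i.i.d.}{\sim}F$, the energy distance between $F$ and $F_{\mathcal{P}_n}$ is $$E(F,F_{\mathcal{P}_n})=\frac{2}{n}\sum_{i=1}^n\mathbb{E}\|\boldsymbol{x}_i-Y\|_2-\frac{1}{n^2}\sum_{i=1}^n\sum_{j=1}^n\|\boldsymbol{x}_i-\boldsymbol{x}_j\|_2-\mathbb{E}\|Y-Y'\|_2 ,$$ assuming these expectations are finite. The energy distance between two empirical distributions of point sets $\mathcal{P}_n=\{\boldsymbol{x}_i\}_{i=1}^n$ and $\mathcal{Q}_m=\{\boldsymbol{w}_j\}_{j=1}^m$ is given by the same formula with $F$ replaced by $F_{\mathcal{Q}_m}$, i.e. $$E(F_{\mathcal{Q}_m},F_{\mathcal{P}_n})=\frac{2}{nm}\sum_{i=1}^n\sum_{j=1}^m\|\boldsymbol{x}_i-\boldsymbol{w}_j\|_2-\frac1{n^2}\sum_{i,i'=1}^n\|\boldsymbol{x}_i-\boldsymbol{x}_{i'}\|_2-\frac1{m^2}\sum_{j,j'=1}^m\|\boldsymbol{w}_j-\boldsymbol{w}_{j'}\|_2 .$$ *)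

(* Defs.v *)
From HB Require Import structures.
From mathcomp Require Import all_boot all_order all_algebra.
From mathcomp Require Import all_classical all_reals all_analysis.

Set Implicit Arguments.
Unset Strict Implicit.
Unset Printing Implicit Defensive.

Import Order.TTheory GRing.Theory Num.Theory.
Import numFieldNormedType.Exports.

Local Open Scope classical_set_scope.
Local Open Scope ring_scope.

(* The Euclidean norm: the library norm on matrices is the sup norm. *)
Definition norm2 (R : realType) (p : nat) (v : 'rV[R]_p) : R :=
  Num.sqrt (\sum_(j < p) v ord0 j ^+ 2).

(* R^p with its Borel sigma-algebra; convertible to 'rV[R]_p. *)
Notation borel_rV R p := (g_sigma_algebraType (@open 'rV[R]_p)).

(* mu is the law on R^p whose joint distribution function is F. *)
Definition has_cdf (R : realType) (p : nat)
    (mu : probability (borel_rV R p) R) (F : 'rV[R]_p -> R) : Prop :=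
  forall t : 'rV[R]_p,
    mu [set y : 'rV[R]_p | forall j, y ord0 j <= t ord0 j] = (F t)%:E.

(* A point set is a family x together with a finite set A of indices: its
   points are the x i for i in A, counted with multiplicity.  Subsets of a
   point set keep x and shrink A. *)

(* The law whose distribution function is the empirical distribution function
   of the points x i, i in A (the zero measure when A is empty). *)
Section empirical.
Local Open Scope ereal_scope.
Context (R : realType) (p : nat) (I : finType).
Variables (x : I -> 'rV[R]_p) (A : {set I}).

Definition empirical (B : set (borel_rV R p)) : \bar R :=
  (#|A|%:R^-1)%:E * \sum_(i in A) \d_(x i : borel_rV R p) B.

Let empirical0 : empirical set0 = 0.
Proof. by rewrite /empirical big1 ?mule0// => i _; rewrite measure0. Qed.

Let empirical_ge0 B : 0 <= empirical B.
Proof.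
apply: mule_ge0; first by rewrite lee_fin invr_ge0.
by apply: sume_ge0 => i _; exact: measure_ge0.
Qed.

Let point (k : nat) : borel_rV R p := nth (0%R : 'rV[R]_p) [seq x i | i in A] k.

Let empiricalE : empirical =
  mscale (((#|A|%:R : R)^-1)%:nng)%R (msum (fun k => \d_(point k)) #|A|).
Proof.
apply/funext => B; rewrite /empirical /mscale /msum /=; congr (_ * _).
rewrite -(big_image _ _ x _ (fun y : 'rV[R]_p => \d_(y : borel_rV R p) B)).
by rewrite (big_nth (0%R : 'rV[R]_p)) size_map -cardE big_mkord.
Qed.

Let empirical_sigma_additive : semi_sigma_additive empirical.
Proof. by rewrite empiricalE; exact: measure_semi_sigma_additive. Qed.

HB.instance Definition _ := isMeasure.Build _ _ _ empirical
  empirical0 empirical_ge0 empirical_sigma_additive.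

Let empirical_fin : fin_num_fun empirical.
Proof.
move=> B _; rewrite /empirical fin_numM// sum_fin_num.
by apply/allP => _ /mapP[i _ ->]; rewrite diracE.
Qed.

HB.instance Definition _ :=
  Measure_isFinite.Build _ _ _ empirical empirical_fin.

End empirical.

(* The energy distance E(F, F_P) between the distribution with law mu and the
   point set P = (x, A): with Y, Y' i.i.d. of law mu, the pair (Y, Y') has law
   mu \x mu. The integrals are real-valued, hence meaningful only when the
   expectations are finite. *)
Definition energy (R : realType) (p : nat) (I : finType)
    (mu : {finite_measure set (borel_rV R p) -> \bar R})
    (x : I -> 'rV[R]_p) (A : {set I}) : R :=
  2 / #|A|%:R * (\sum_(i in A) \int[mu]_y norm2 (x i - y))
  - (#|A|%:R ^+ 2)^-1 * (\sum_(i in A) \sum_(j in A) norm2 (x i - x j))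
  - \int[(mu \x mu)%E]_z norm2 (z.1 - z.2).

(* The point set (x, [set: 'I_n]) is divided into the (x, S k): the S k are the
   classes, all nonempty, of a partition of the index set. *)
Definition is_division (n K : nat) (S : 'I_K -> {set 'I_n}) : Prop :=
  [/\ (\bigcup_(k < K) S k = [set: 'I_n])%SET,
      forall k1 k2, k1 != k2 -> S k1 :&: S k2 = finset.set0
    & forall k, (0 < #|S k|)%N].

(* Main.v *)
Require Import Defs.
From mathcomp Require Import all_boot all_order all_algebra.
From mathcomp Require Import all_classical all_reals all_analysis.
From mathcomp Require Import measurable_realfun ring zify.

Set Implicit Arguments.
Unset Strict Implicit.
Unset Printing Implicit Defensive.

Import Order.TTheory GRing.Theory Num.Theory.
Import numFieldNormedType.Exports.

Local Open Scope classical_set_scope.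
Local Open Scope ring_scope.

(** For a fixed law nu, the energy distance from nu to a point set P is
    2 E|X - Y| - E|X - X'| - E|Y - Y'|, with X, X' drawn from P and Y, Y' from
    nu.  When P is divided into classes S k of weight w k = n_k / n, the
    empirical law of P is the mixture of those of the S k.  The cross term is
    linear in that mixture and the last term is constant (the weights sum to 1),
    so the gap
      sum_k w k * E(nu, S k) - E(nu, P)
    comes only from the quadratic term E|X - X'|.  It is therefore a number
    [dispersion] that does not depend on nu ([sum_energy_dispersion]).

    All the identities follow by choosing nu:
    - nu = mu expresses E(mu, P) as the weighted sum minus the dispersion;
    - nu = the empirical law of P gives dispersion = sum_k w k * E(P, S k), as
      E(P, P) = 0 ([sum_energy_total]);
    - nu = the empirical law of S k, averaged with weights w k, gives
      sum_k sum_l w k * w l * E(S k, S l)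
        = sum_k w k * E(S k, P) + dispersion = 2 * dispersion
      by symmetry of E and the previous point ([sum_energy_classes]); as
      E is symmetric and vanishes on the diagonal, half of the double sum is the
      sum over the pairs k < l ([sum_sym_pairs]).

    The analytic part is that integrals of the Euclidean distance against
    empirical laws and their products are the expected finite averages, whence
    the closed form [energy_empirical], from which the symmetry and the
    vanishing on the diagonal are read off.  Every integrand is nonnegative and
    measurable, so these computations take place in the extended reals and use
    Tonelli's theorem. *)

(** * Measurability of the Euclidean distance *)

Section euclidean_distance.
Context (R : realType) (p : nat).

Lemma norm2_ge0 (v : 'rV[R]_p) : 0 <= norm2 v.
Proof. exact: sqrtr_ge0. Qed.

Lemma norm2_distC (u v : 'rV[R]_p) : norm2 (u - v) = norm2 (v - u).
Proof.
by congr Num.sqrt; apply: eq_bigr => j _; rewrite !mxE -sqrrN opprB.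
Qed.

Lemma measurable_coord (j : 'I_p) :
  measurable_fun setT (fun y : borel_rV R p => (y : 'rV[R]_p) ord0 j).
Proof.
apply: (measurability _ (RGenOpens.measurableE R)) => _ [_ [a [b ->]] <-].
rewrite setTI; apply: sub_sigma_algebra.
have /continuousP := @coord_continuous R 1 p ord0 j; apply.
exact: interval_open.
Qed.

(** The integrand depends on the points through their coordinates only, so
    measurability is checked coordinatewise: this gives joint measurability for
    the product sigma-algebra without comparing it to the Borel sigma-algebra
    of the product space. *)
Lemma measurable_norm2_dist d (T : measurableType d)
    (f g : T -> borel_rV R p) :
  measurable_fun setT f -> measurable_fun setT g ->
  measurable_fun setT (fun t => norm2 ((f t : 'rV[R]_p) - (g t : 'rV[R]_p))).
Proof.
move=> mf mg; rewrite /norm2.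
apply: (measurableT_comp (f := @Num.sqrt R)).
  exact: (continuous_measurable_fun (@sqrt_continuous R)).
apply: measurable_sum => j; apply: measurable_funX.
rewrite [X in measurable_fun _ X](_ : _ = (fun t =>
  (f t : 'rV[R]_p) ord0 j - (g t : 'rV[R]_p) ord0 j)); last first.
  by apply/funext => t; rewrite !mxE.
by apply: measurable_funB; exact: (measurableT_comp (measurable_coord j)).
Qed.

End euclidean_distance.

(** * Integration against an empirical law *)

Section empirical_integral.
Context (R : realType) (p : nat) (I : finType).
Implicit Types (x : I -> 'rV[R]_p) (A : {set I}).

(** The empirical law is a scaled finite sum of Dirac masses; since [msum] takes
    a sequence of measures, the points are listed along the enumeration of A. *)
Lemma ge0_integral_empirical x A (f : borel_rV R p -> \bar R) :
  measurable_fun setT f -> (forall y, 0 <= f y)%E ->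
  (\int[empirical x A]_y f y =
    (#|A|%:R^-1)%:E * \sum_(i in A) f (x i : borel_rV R p))%E.
Proof.
move=> mf f0.
pose point k : borel_rV R p := nth (0 : 'rV[R]_p) [seq x i | i in A] k.
have sum_point (g : borel_rV R p -> \bar R) :
    (\sum_(k < #|A|) g (point k) = \sum_(i in A) g (x i : borel_rV R p))%E.
  rewrite -(big_image _ _ x _ (fun y : 'rV[R]_p => g (y : borel_rV R p))).
  by rewrite (big_nth (0 : 'rV[R]_p)) size_map -cardE big_mkord.
rewrite (eq_measure_integral (mscale (((#|A|%:R : R)^-1)%:nng)
  (msum (fun k => \d_(point k)) #|A|))); last first.
  move=> B mB _; rewrite /= /empirical /mscale /msum /=; congr (_ * _)%E.
  exact/esym/(sum_point (fun y => \d_y B)).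
rewrite ge0_integral_mscale// ge0_integral_measure_sum//.
congr (_ * _)%E; rewrite -sum_point; apply: eq_bigr => k _.
by rewrite integral_dirac// diracT mul1e.
Qed.

Lemma Rintegral_empirical_norm2 x A (u : 'rV[R]_p) :
  \int[empirical x A]_y norm2 (u - y) =
  #|A|%:R^-1 * \sum_(i in A) norm2 (u - x i).
Proof.
rewrite /Rintegral ge0_integral_empirical.
- by rewrite sumEFin -EFinM.
- apply/measurable_EFinP.
  exact: (measurable_norm2_dist (f := cst (u : borel_rV R p))).
- by move=> y; rewrite lee_fin norm2_ge0.
Qed.

Lemma Rintegral_empirical2_norm2 x A :
  \int[(empirical x A \x empirical x A)%E]_z norm2 (z.1 - z.2) =
  (#|A|%:R ^+ 2)^-1 * \sum_(i in A) \sum_(j in A) norm2 (x i - x j).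
Proof.
have mD : measurable_fun [set: borel_rV R p * borel_rV R p]
    (fun z => (norm2 ((z.1 : 'rV[R]_p) - (z.2 : 'rV[R]_p)))%:E).
  apply/measurable_EFinP.
  exact: measurable_norm2_dist measurable_fst measurable_snd.
have D0 (z : borel_rV R p * borel_rV R p) :
    (0 <= (norm2 ((z.1 : 'rV[R]_p) - (z.2 : 'rV[R]_p)))%:E)%E.
  by rewrite lee_fin norm2_ge0.
rewrite /Rintegral fubini_tonelli1//.
rewrite ge0_integral_empirical; last 2 first.
- exact: measurable_fun_fubini_tonelli_F.
- by move=> y; apply: integral_ge0 => z _; exact: D0.
rewrite (eq_bigr (fun i => (#|A|%:R^-1 *
    \sum_(j in A) norm2 (x i - x j))%:E)); last first.
  move=> i _; rewrite /fubini_F ge0_integral_empirical; last 2 first.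
  - exact: (measurableT_comp mD (measurable_pair1 _)).
  - by move=> y; exact: D0.
  by rewrite sumEFin -EFinM.
by rewrite sumEFin -EFinM /= -mulr_sumr mulrA -invfM -expr2.
Qed.

End empirical_integral.

(** * The energy distance between two point sets *)

Section energy_empirical.
Context (R : realType) (p : nat) (I : finType).
Implicit Types (x : I -> 'rV[R]_p) (A B : {set I}).

Lemma energy_empirical x A B :
  energy (empirical x A) x B =
  2 / (#|B|%:R * #|A|%:R) * (\sum_(i in B) \sum_(j in A) norm2 (x i - x j))
  - (#|B|%:R ^+ 2)^-1 * (\sum_(i in B) \sum_(j in B) norm2 (x i - x j))
  - (#|A|%:R ^+ 2)^-1 * (\sum_(i in A) \sum_(j in A) norm2 (x i - x j)).
Proof.
rewrite /energy Rintegral_empirical2_norm2.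
under eq_bigr do rewrite Rintegral_empirical_norm2.
congr (_ - _ - _).
by rewrite -mulr_sumr [in RHS]invfM [in RHS]mulrA -[RHS]mulrA.
Qed.

Lemma energy_empiricalC x A B :
  energy (empirical x A) x B = energy (empirical x B) x A.
Proof.
rewrite !energy_empirical exchange_big /= [_ * #|A|%:R]mulrC.
under eq_bigr do under eq_bigr do rewrite norm2_distC.
by rewrite addrAC.
Qed.

Lemma energy_empirical_diag x A : energy (empirical x A) x A = 0.
Proof. by rewrite energy_empirical -expr2; ring. Qed.

End energy_empirical.

(** * Division into classes and dispersion *)

Section division.
Context (R : realType) (p n K : nat).
Variables (x : 'I_n -> 'rV[R]_p) (S : 'I_K -> {set 'I_n}).
Hypotheses (K_gt0 : (0 < K)%N) (divS : is_division S).

Lemma division_sum (f : 'I_n -> R) :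
  \sum_(i in [set: 'I_n]%SET) f i = \sum_(k < K) \sum_(i in S k) f i.
Proof.
case: divS => <- disjS _; apply: partition_disjoint_bigcup => k l /disjS/eqP.
by rewrite finset.setI_eq0.
Qed.

Lemma card_class_neq0 k : #|S k|%:R != 0 :> R.
Proof. by case: divS => _ _ S0; rewrite pnatr_eq0 -lt0n. Qed.

Lemma card_total_neq0 : n%:R != 0 :> R.
Proof.
case: divS => _ _ /(_ (Ordinal K_gt0)) S0; rewrite pnatr_eq0 -lt0n.
by rewrite (leq_trans S0)// -[leqRHS]card_ord max_card.
Qed.

Lemma division_weights_sum1 : \sum_(k < K) #|S k|%:R / n%:R = 1 :> R.
Proof.
have := division_sum (fun=> 1).
rewrite !sumr_const cardsT card_ord.
under eq_bigr do rewrite sumr_const.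
by rewrite -mulr_suml => <-; rewrite mulfV// card_total_neq0.
Qed.

(** This is the mean distance between two points of the whole set, minus the
    weighted average of the mean distances inside the classes. *)
Definition dispersion : R :=
  (n%:R ^+ 2)^-1 * (\sum_(i < n) \sum_(j < n) norm2 (x i - x j))
  - \sum_(k < K) (n%:R * #|S k|%:R)^-1
      * (\sum_(i in S k) \sum_(j in S k) norm2 (x i - x j)).

(** The factor n_k / n turns the 1 / n_k of the cross term into 1 / n, so the
    cross terms add up to that of the whole set; it turns the 1 / n_k^2 of the
    quadratic term into 1 / (n n_k), and only these terms differ from the energy
    of the whole set.  No integral is evaluated, so nu can be any finite
    measure. *)
Lemma sum_energy_dispersion
    (nu : {finite_measure set (borel_rV R p) -> \bar R}) :
  \sum_(k < K) #|S k|%:R / n%:R * energy nu x (S k) =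
  energy nu x [set: 'I_n]%SET + dispersion.
Proof.
pose a i := \int[nu]_y norm2 (x i - y).
pose c := \int[(nu \x nu)%E]_z norm2 (z.1 - z.2).
pose M k := \sum_(i in S k) \sum_(j in S k) norm2 (x i - x j).
have n0 := card_total_neq0.
transitivity (\sum_(k < K) (2 / n%:R * (\sum_(i in S k) a i)
    - (n%:R * #|S k|%:R)^-1 * M k - #|S k|%:R / n%:R * c)).
  apply: eq_bigr => k _; rewrite /energy -/c -/(M k) /a.
  have := card_class_neq0 k; set m : R := #|S k|%:R => m0.
  by field; rewrite m0 n0.
rewrite !big_split /= !sumrN -mulr_sumr -mulr_suml division_weights_sum1 mul1r.
rewrite -division_sum /energy /dispersion -/c cardsT card_ord /a.
rewrite [\sum_(i in [set: 'I_n]%SET) \sum_(j in _) _](_ : _ =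
    \sum_(i < n) \sum_(j < n) norm2 (x i - x j)); last first.
  rewrite (eq_bigl xpredT) => [|i]; last by rewrite inE.
  by apply: eq_bigr => i _; apply: eq_bigl => j; rewrite inE.
by rewrite /M; ring.
Qed.

Lemma sum_energy_total :
  \sum_(k < K) #|S k|%:R / n%:R * energy (empirical x [set: 'I_n]%SET) x (S k)
  = dispersion.
Proof. by rewrite sum_energy_dispersion energy_empirical_diag add0r. Qed.

(** Summing over l first applies [sum_energy_dispersion] to the empirical law of
    S k; the energies E(S k, P) that this leaves average to the dispersion. *)
Lemma sum_energy_classes :
  \sum_(k < K) \sum_(l < K) #|S k|%:R * #|S l|%:R / (2 * n%:R ^+ 2)
    * energy (empirical x (S k)) x (S l) = dispersion.
Proof.
have n0 := card_total_neq0.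
transitivity (\sum_(k < K) 2^-1 * (#|S k|%:R / n%:R
    * energy (empirical x [set: 'I_n]%SET) x (S k)
    + #|S k|%:R / n%:R * dispersion)).
  apply: eq_bigr => k _.
  rewrite energy_empiricalC -mulrDr -sum_energy_dispersion 2!mulr_sumr.
  by apply: eq_bigr => l _; field.
rewrite -mulr_sumr big_split /= sum_energy_total -mulr_suml.
by rewrite division_weights_sum1; field.
Qed.

End division.

(** * Symmetric double sums and the decomposition of the energy *)

Lemma sum_sym_pairs (V : nmodType) (K : nat) (f : 'I_K -> 'I_K -> V) :
  (forall k l, f k l = f l k) -> (forall k, f k k = 0) ->
  \sum_(k < K) \sum_(l < K) f k l =
  (\sum_(k < K) \sum_(l < K | (k < l)%N) f k l) *+ 2.
Proof.
move=> fC f0.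
transitivity (\sum_(k < K) (\sum_(l < K | (k < l)%N) f k l
    + \sum_(l < K | (l < k)%N) f k l)).
  apply: eq_bigr => k _; rewrite (bigID (fun l : 'I_K => (k < l)%N)) /=.
  congr (_ + _); rewrite (bigD1 k) ?ltnn//= f0 add0r.
  by apply: eq_bigl => l; rewrite -leqNgt andbC -val_eqE -ltn_neqAle.
rewrite big_split /= mulr2n; congr (_ + _).
rewrite (exchange_big_dep xpredT)//=; apply: eq_bigr => k _.
by apply: eq_bigr => l _; exact: fC.
Qed.

Theorem theorem1 (R : realType) (p : nat) (X : set 'rV[R]_p)
    (F : 'rV[R]_p -> R) (mu : probability (borel_rV R p) R)
    (n K : nat) (x : 'I_n -> 'rV[R]_p) (S : 'I_K -> {set 'I_n}) :
  has_cdf mu F ->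
  continuous F ->
  {ae mu, forall y, X y} ->
  (forall i, X (x i)) ->
  (forall i, (\int[mu]_y (norm2 (x i - y))%:E < +oo)%E) ->
  (\int[mu \x mu]_z (norm2 (z.1 - z.2))%:E < +oo)%E ->
  (0 < K)%N ->
  is_division S ->
  let P_n := [set: 'I_n]%SET in
  [/\ energy mu x P_n =
        \sum_(k < K) #|S k|%:R / n%:R * energy mu x (S k)
        - \sum_(k1 < K) \sum_(k2 < K | (k1 < k2)%N)
            #|S k1|%:R * #|S k2|%:R / n%:R ^+ 2
            * energy (empirical x (S k1)) x (S k2),
      energy mu x P_n =
        \sum_(k < K) #|S k|%:R / n%:R * energy mu x (S k)
        - \sum_(k1 < K) \sum_(k2 < K)
            #|S k1|%:R * #|S k2|%:R / (2 * n%:R ^+ 2)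
            * energy (empirical x (S k1)) x (S k2),
      energy mu x P_n =
        \sum_(k < K) #|S k|%:R / n%:R
          * (energy mu x (S k) - energy (empirical x P_n) x (S k))
    & K = 2%N -> forall k1 k2 : 'I_K, (k1 < k2)%N ->
      energy mu x P_n =
        #|S k1|%:R / n%:R * energy mu x (S k1)
        + #|S k2|%:R / n%:R * energy mu x (S k2)
        - #|S k1|%:R * #|S k2|%:R / n%:R ^+ 2
          * energy (empirical x (S k1)) x (S k2)].
Proof.
move=> _ _ _ _ _ _ K_gt0 divS P_n.
have n0 : n%:R != 0 :> R := card_total_neq0 R K_gt0 divS.
have total : energy mu x P_n =
    \sum_(k < K) #|S k|%:R / n%:R * energy mu x (S k) - dispersion x S.
  by rewrite (sum_energy_dispersion _ K_gt0 divS) addrK.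
have pairs : dispersion x S = \sum_(k1 < K) \sum_(k2 < K | (k1 < k2)%N)
    #|S k1|%:R * #|S k2|%:R / n%:R ^+ 2 * energy (empirical x (S k1)) x (S k2).
  rewrite -(sum_energy_classes x K_gt0 divS) sum_sym_pairs; last 2 first.
  - by move=> k l; rewrite energy_empiricalC [#|S k|%:R * _]mulrC.
  - by move=> k; rewrite energy_empirical_diag mulr0.
  rewrite -sumrMnl; apply: eq_bigr => k _.
  by rewrite -sumrMnl; apply: eq_bigr => l _; field.
split.
- by rewrite total pairs.
- by rewrite total (sum_energy_classes x K_gt0 divS).
- under eq_bigr do rewrite mulrBr.
  by rewrite big_split /= sumrN (sum_energy_total x K_gt0 divS).
- move=> K2; subst K => k1 k2 lt12.
  (* In 'I_2 the only pair k1 < k2 is (0, 1). *)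
  have -> : k1 = ord0 by apply/val_inj => /=; move: (ltn_ord k2) lt12; lia.
  have -> : k2 = ord_max by apply/val_inj => /=; move: (ltn_ord k2) lt12; lia.
  have lift0 : lift ord0 ord0 = ord_max :> 'I_2 by exact: val_inj.
  rewrite total pairs !big_ord_recl !big_ord0 lift0.
  rewrite big_mkcond !big_ord_recl !big_ord0 /=.
  rewrite big_mkcond !big_ord_recl !big_ord0 /= lift0.
  by rewrite !(addr0, add0r).
Qed.
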